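(* The functional $C_B$ (Boolean-valued coherence measure) defined on pure states by $C_B(|\psi\rangle)=1$ if $|\psi\rangle$ is a coherent state and $C_B(|\psi\rangle)=0$ if $|\psi\rangle$ is an incoherent state, and extended to arbitrary density operators $\rho$ on $\mathbb{C}^d$ by $$C_B(\rho)=\inf_{\{p_i,|\psi_i\rangle\}}\sum_i p_i\,C_B(|\psi_i\rangle),$$ where the infimum is over all (finite) pure-state ensembles with $\rho=\sum_i p_i|\psi_i\rangle\langle\psi_i|$, $p_i\ge 0$, $\sum_i p_i=1$, is a coherence measure, that is, it satisfies: (C1) $C_B(\rho)\ge 0$ for every state $\rho$, with $C_B(\rho)=0$ if and only if $\rho\in\mathcal{I}$; (C2) $C_B(\Lambda(\rho))\le C_B(\rho)$ for every incoherent operation $\Lambda$ and every state $\rho$; (C3) for every state $\rho$ and every set of incoherent Kraus operators $\{K_n\}$ (with $\sum_n K_n^\dagger K_n=I$), $\sum_n q_n C_B(\sigma_n)\le C_B(\rho)$, where $q_n=\operatorname{Tr}[K_n\rho K_n^\dagger]$, $\sigma_n=K_n\rho K_n^\dagger/q_n$, and terms with $q_n=0$ are omitted; (C4) $C_B\left(\sum_i p_i\rho_i\right)\le\sum_i p_i C_B(\rho_i)$ for all states $\rho_i$ and probabilities $p_i$.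
   Context: Fix a reference orthonormal basis $\{|i\rangle\}_{i=0}^{d-1}$ of $\mathbb{C}^d$. A state (density operator) is incoherent if it is diagonal in this basis; the set of incoherent states is $\mathcal{I}$; all other states are coherent. A unit vector $|\psi\rangle$ is called incoherent or coherent according to whether $|\psi\rangle\langle\psi|$ is. An incoherent operation is a completely positive trace-preserving map $\Lambda(\rho)=\sum_{n=1}^N K_n\rho K_n^\dagger$ with $\sum_{n=1}^N K_n^\dagger K_n=I$ and $K_n\mathcal{I}K_n^\dagger\subset\mathcal{I}$ for each $n$ (up to normalization, i.e. each $K_n$ maps diagonal density matrices to diagonal positive semidefinite matrices); such $K_n$ are called incoherent Kraus operators. *)

(* Defs.v *)
(* Mathematical Components, with real numbers R : realType and complex
   numbers R[i]. *)
From HB Require Import structures.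
From mathcomp Require Import all_boot all_order all_algebra.
From mathcomp Require Import spectral complex.
From mathcomp Require Import boolp classical_sets reals.

Set Implicit Arguments.
Unset Strict Implicit.
Unset Printing Implicit Defensive.

Import Order.TTheory GRing.Theory Num.Theory.

Local Open Scope ring_scope.
Local Open Scope classical_set_scope.
Local Open Scope complex_scope.
Local Open Scope sesquilinear_scope.

(* The reference orthonormal basis is the standard basis of C^d, so "diagonal
   in the reference basis" is [is_diag_mx]. *)

(* On R[i], [0 <= z] says that z is real and nonnegative; over the complex
   numbers this forces A to be Hermitian. *)
Definition psdmx (R : realType) (d : nat) (A : 'M[R[i]]_d) : Prop :=
  forall v : 'cV[R[i]]_d, 0 <= (v^t* *m A *m v) 0 0.

Definition density (R : realType) (d : nat) (rho : 'M[R[i]]_d) : Prop :=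
  psdmx rho /\ \tr rho = 1.

Definition incoherent (R : realType) (d : nat) (rho : 'M[R[i]]_d) : Prop :=
  density rho /\ is_diag_mx rho.

Definition unit_vector (R : realType) (d : nat) (psi : 'cV[R[i]]_d) : Prop :=
  psi^t* *m psi = 1%:M.

(* |psi><psi| *)
Definition ketbra (R : realType) (d : nat) (psi : 'cV[R[i]]_d) : 'M[R[i]]_d :=
  psi *m psi^t*.

Definition prob_vector (R : realType) (n : nat) (p : 'I_n -> R) : Prop :=
  (forall i, 0 <= p i) /\ \sum_(i < n) p i = 1.

Definition pure_ensemble (R : realType) (d n : nat) (rho : 'M[R[i]]_d)
    (p : 'I_n -> R) (psi : 'I_n -> 'cV[R[i]]_d) : Prop :=
  [/\ prob_vector p,
      forall i, unit_vector (psi i)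
    & rho = \sum_(i < n) (p i)%:C *: ketbra (psi i)].

Definition CB_pure (R : realType) (d : nat) (psi : 'cV[R[i]]_d) : R :=
  if `[< incoherent (ketbra psi) >] then 0 else 1.

(* Only meaningful on density operators, where the set is nonempty (spectral
   decomposition) and bounded below by 0, so that [inf] is the true infimum. *)
Definition CB (R : realType) (d : nat) (rho : 'M[R[i]]_d) : R :=
  inf [set x : R | exists (n : nat) (p : 'I_n -> R)
                          (psi : 'I_n -> 'cV[R[i]]_d),
         pure_ensemble rho p psi /\ x = \sum_(i < n) p i * CB_pure (psi i)].

Definition incoherent_kraus (R : realType) (d : nat) (K : 'M[R[i]]_d) : Prop :=
  forall rho : 'M[R[i]]_d, incoherent rho ->
    psdmx (K *m rho *m K^t*) /\ is_diag_mx (K *m rho *m K^t*).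

Definition incoherent_kraus_family (R : realType) (d N : nat)
    (K : 'I_N -> 'M[R[i]]_d) : Prop :=
  \sum_(n < N) (K n)^t* *m K n = 1%:M /\ forall n, incoherent_kraus (K n).

(* Complete positivity and trace preservation are carried by the Kraus form. *)
Definition incoherent_operation (R : realType) (d : nat)
    (Lambda : 'M[R[i]]_d -> 'M[R[i]]_d) : Prop :=
  exists (N : nat) (K : 'I_N -> 'M[R[i]]_d),
    incoherent_kraus_family K /\
    forall rho, Lambda rho = \sum_(n < N) K n *m rho *m (K n)^t*.

(* The trace is a nonnegative real when rho is a density operator, so taking
   the real part only changes its type. *)
Definition outcome_prob (R : realType) (d : nat) (K rho : 'M[R[i]]_d) : R :=
  complex.Re (\tr (K *m rho *m K^t*)).

Definition outcome_state (R : realType) (d : nat) (K rho : 'M[R[i]]_d) :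
    'M[R[i]]_d :=
  ((outcome_prob K rho)^-1)%:C *: (K *m rho *m K^t*).

Record coherence_measure (R : realType) (d : nat)
    (C : 'M[R[i]]_d -> R) : Prop := CoherenceMeasure {
  coherence_faithful : forall rho, density rho ->
    0 <= C rho /\ (C rho = 0 <-> incoherent rho);
  coherence_monotone : forall Lambda rho,
    incoherent_operation Lambda -> density rho -> C (Lambda rho) <= C rho;
  coherence_strong_monotone : forall (N : nat) (K : 'I_N -> 'M[R[i]]_d) rho,
    incoherent_kraus_family K -> density rho ->
    \sum_(n < N | outcome_prob (K n) rho != 0)
      outcome_prob (K n) rho * C (outcome_state (K n) rho) <= C rho;
  coherence_convex : forall (m : nat) (p : 'I_m -> R)
      (rho : 'I_m -> 'M[R[i]]_d),
    prob_vector p -> (forall i, density (rho i)) ->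
    C (\sum_(i < m) (p i)%:C *: rho i) <= \sum_(i < m) p i * C (rho i)
}.

(* Main.v *)
(* Absorbing each probability into its vector, an ensemble of rho is a list of
   unnormalized vectors v with rho = \sum_v |v><v|, and its C_B-value is the
   total of [cost v], which is |v|^2 if |v><v| is not diagonal and 0 otherwise.
   This cost is homogeneous of degree 2, and a family of incoherent Kraus
   operators satisfies \sum_n cost (K_n v) <= cost v: a diagonal |v><v| stays
   diagonal under every K_n, and otherwise \sum_n |K_n v|^2 = |v|^2.  Pushing
   near-optimal lists through the K_n gives (C2) and (C3), concatenating them
   gives (C4).  For faithfulness no minimizer is needed: only the vectors with
   nonzero cost contribute off-diagonal entries, so that
   |rho_jk| <= C_B(rho) for all j != k. *)
Require Import Defs.
From mathcomp Require Import all_boot all_order all_algebra.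
From mathcomp Require Import complex reals.
From mathcomp Require Import spectral boolp classical_sets.
From mathcomp Require Import ring.

Set Implicit Arguments.
Unset Strict Implicit.
Unset Printing Implicit Defensive.

Import Order.TTheory GRing.Theory Num.Theory.

Local Open Scope ring_scope.
Local Open Scope classical_set_scope.
Local Open Scope complex_scope.
Local Open Scope sesquilinear_scope.

(** * Squared norms, rank-one matrices and the cost of an unnormalized vector *)

Lemma conjC_realc (R : realType) (a : R) : Num.conj a%:C = a%:C.
Proof. exact: conjc_real. Qed.

Definition sqnorm (R : realType) (d : nat) (v : 'cV[R[i]]_d) : R :=
  complex.Re ((v^t* *m v) 0 0).

(** The test is diagonality alone, not [incoherent], so that it makes sense for vectors of any norm;
    on unit vectors the two agree and [cost] is [CB_pure]. *)
Definition cost (R : realType) (d : nat) (v : 'cV[R[i]]_d) : R :=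
  if is_diag_mx (ketbra v) then 0 else sqnorm v.

Lemma sqnormE (R : realType) (d : nat) (v : 'cV[R[i]]_d) :
  (sqnorm v)%:C = (v^t* *m v) 0 0.
Proof.
rewrite /sqnorm RRe_real // mxE.
apply: rpred_sum => j _; rewrite !mxE mulrC -normCK.
exact/rpredX/normr_real.
Qed.

Lemma ketbraE (R : realType) (d : nat) (v : 'cV[R[i]]_d) j k :
  ketbra v j k = v j 0 * (v k 0)^*.
Proof. by rewrite /ketbra !mxE big_ord1 !mxE. Qed.

Lemma sqnorm_sum (R : realType) (d : nat) (v : 'cV[R[i]]_d) :
  (sqnorm v)%:C = \sum_j `|v j 0| ^+ 2.
Proof.
by rewrite sqnormE mxE; apply: eq_bigr => j _; rewrite !mxE normCK mulrC.
Qed.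

Lemma sqnorm_ge0 (R : realType) (d : nat) (v : 'cV[R[i]]_d) : 0 <= sqnorm v.
Proof.
rewrite -ler0c sqnorm_sum; apply: sumr_ge0 => j _.
exact/exprn_ge0/normr_ge0.
Qed.

Lemma sqnorm0 (R : realType) (d : nat) : sqnorm (0 : 'cV[R[i]]_d) = 0.
Proof. by rewrite /sqnorm mulmx0 mxE. Qed.

Lemma sqnorm_eq0 (R : realType) (d : nat) (v : 'cV[R[i]]_d) :
  sqnorm v = 0 -> v = 0.
Proof.
move=> v0; apply/colP => j; rewrite mxE; apply/eqP.
have /eqP : (sqnorm v)%:C = 0 by rewrite v0.
rewrite sqnorm_sum psumr_eq0; last by move=> k _; exact/exprn_ge0/normr_ge0.
by move=> /allP/(_ j (mem_index_enum _)) /=; rewrite expf_eq0 /= normr_eq0.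
Qed.

Lemma trace_ketbra (R : realType) (d : nat) (v : 'cV[R[i]]_d) :
  \tr (ketbra v) = (sqnorm v)%:C.
Proof. by rewrite /ketbra mxtrace_mulC sqnormE /mxtrace big_ord1. Qed.

Lemma ketbraZ (R : realType) (d : nat) (a : R) (v : 'cV[R[i]]_d) :
  ketbra (a%:C *: v) = (a ^+ 2)%:C *: ketbra v.
Proof.
apply/matrixP => j k; rewrite ketbraE [RHS]mxE ketbraE !mxE !rmorphM/= conjC_realc.
ring.
Qed.

Lemma sqnormZ (R : realType) (d : nat) (a : R) (v : 'cV[R[i]]_d) :
  sqnorm (a%:C *: v) = a ^+ 2 * sqnorm v.
Proof.
apply: complexI; rewrite rmorphM /= -!trace_ketbra ketbraZ.
by rewrite mxtraceZ.
Qed.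

Lemma ketbra_mulmx (R : realType) (d : nat) (K : 'M[R[i]]_d) (v : 'cV[R[i]]_d) :
  K *m ketbra v *m K^t* = ketbra (K *m v).
Proof. by rewrite /ketbra trmx_mul map_mxM !mulmxA. Qed.

Lemma cost_ge0 (R : realType) (d : nat) (v : 'cV[R[i]]_d) : 0 <= cost v.
Proof. by rewrite /cost; case: ifP => // _; exact: sqnorm_ge0. Qed.

Lemma cost_le_sqnorm (R : realType) (d : nat) (v : 'cV[R[i]]_d) :
  cost v <= sqnorm v.
Proof. by rewrite /cost; case: ifP => // _; exact: sqnorm_ge0. Qed.

Lemma is_diag_mxZ (F : fieldType) (m n : nat) (a : F) (A : 'M[F]_(m, n)) :
  a != 0 -> is_diag_mx (a *: A) = is_diag_mx A.
Proof.
move=> a0; apply/is_diag_mxP/is_diag_mxP => h i j ij; have := h i j ij.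
  by rewrite mxE => /eqP; rewrite mulf_eq0 (negPf a0) => /eqP.
by rewrite mxE => ->; rewrite mulr0.
Qed.

Lemma costZ (R : realType) (d : nat) (a : R) (v : 'cV[R[i]]_d) :
  cost (a%:C *: v) = a ^+ 2 * cost v.
Proof.
rewrite /cost sqnormZ ketbraZ; have [->|a0] := eqVneq a 0.
  by rewrite expr0n /= !mul0r !if_same.
by rewrite is_diag_mxZ ?(fun_if ( *%R _)) ?mulr0 // (inj_eq (@complexI R)) sqrf_eq0.
Qed.

Lemma unit_sqnorm (R : realType) (d : nat) (v : 'cV[R[i]]_d) :
  unit_vector v <-> sqnorm v = 1.
Proof.
rewrite /unit_vector; split=> [h|h].
  by apply: complexI; rewrite sqnormE h mxE eqxx.
by apply/matrixP => i j; rewrite !ord1 -sqnormE h mxE eqxx.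
Qed.

Lemma normalize (R : realType) (d : nat) (v : 'cV[R[i]]_d) :
  v != 0 -> exists (a : R) (u : 'cV_d),
    [/\ a != 0, unit_vector u & v = a%:C *: u].
Proof.
move=> v0; have n0 : 0 < sqnorm v.
  rewrite lt_neqAle sqnorm_ge0 andbT eq_sym.
  by apply: contra v0 => /eqP/sqnorm_eq0 ->.
pose a := Num.sqrt (sqnorm v).
have a0 : a != 0 by rewrite gt_eqF // sqrtr_gt0.
have a0C : a%:C != 0 by rewrite (inj_eq (@complexI R)).
exists a, ((a^-1)%:C *: v); split=> //.
  by apply/unit_sqnorm; rewrite sqnormZ exprVn sqr_sqrtr ?ltW// mulVf ?gt_eqF.
by rewrite scalerA -rmorphM /= mulfV // scale1r.
Qed.

Lemma psdmx_ketbra (R : realType) (d : nat) (v : 'cV[R[i]]_d) :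
  psdmx (ketbra v).
Proof.
move=> u; rewrite /ketbra mulmxA -mulmxA mxE big_ord1.
have -> : (v^t* *m u) 0 0 = Num.conj ((u^t* *m v) 0 0).
  rewrite !mxE rmorph_sum; apply: eq_bigr => j _.
  by rewrite !mxE rmorphM /= conjCK mulrC.
exact: mul_conjC_ge0.
Qed.

Lemma incoherent_ketbra (R : realType) (d : nat) (u : 'cV[R[i]]_d) :
  unit_vector u -> incoherent (ketbra u) <-> is_diag_mx (ketbra u).
Proof.
move=> /unit_sqnorm u1; split=> [[]//|h]; split=> //; split.
  exact: psdmx_ketbra.
by rewrite trace_ketbra u1.
Qed.

Lemma CB_pure_cost (R : realType) (d : nat) (u : 'cV[R[i]]_d) :
  unit_vector u -> CB_pure u = cost u.
Proof.
move=> u1; rewrite /CB_pure /cost (unit_sqnorm u).1 //.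
case: asboolP => [/(incoherent_ketbra u1) -> //|].
by case: ifPn => // h; case; apply/incoherent_ketbra.
Qed.

(** * Cost under incoherent Kraus operators *)

(** [incoherent_kraus] speaks only of states, so a nonzero [v] is first normalized; the scalar comes
    back through homogeneity of the cost. *)
Lemma incoherent_kraus_cost_eq0 (R : realType) (d : nat) (K : 'M[R[i]]_d)
    (v : 'cV[R[i]]_d) :
  incoherent_kraus K -> is_diag_mx (ketbra v) -> cost (K *m v) = 0.
Proof.
move=> iK; have [->|v0] := eqVneq v 0.
  by move=> _; rewrite mulmx0 /cost sqnorm0 if_same.
have [a [u [a0 u1 ->]]] := normalize v0.
rewrite -scalemxAr costZ ketbraZ is_diag_mxZ; last first.
  by rewrite (inj_eq (@complexI R)) sqrf_eq0.
move=> /(incoherent_ketbra u1)/iK[_]; rewrite ketbra_mulmx /cost => ->.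
by rewrite mulr0.
Qed.

Lemma sum_sqnorm_kraus (R : realType) (d N : nat) (K : 'I_N -> 'M[R[i]]_d)
    (v : 'cV[R[i]]_d) :
  \sum_(n < N) (K n)^t* *m K n = 1%:M ->
  \sum_(n < N) sqnorm (K n *m v) = sqnorm v.
Proof.
move=> K1; apply: complexI; rewrite rmorph_sum /= [RHS]sqnormE.
rewrite -[X in _ *m X]mul1mx -K1 mulmx_suml mulmx_sumr summxE.
apply: eq_bigr => n _.
by rewrite sqnormE trmx_mul map_mxM !mulmxA.
Qed.

Lemma sum_cost_kraus (R : realType) (d N : nat) (K : 'I_N -> 'M[R[i]]_d)
    (v : 'cV[R[i]]_d) :
  incoherent_kraus_family K -> \sum_(n < N) cost (K n *m v) <= cost v.
Proof.
move=> [K1 iK]; rewrite [leRHS]/cost; case: ifP => [dv|_].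
  by rewrite big1 // => n _; exact: incoherent_kraus_cost_eq0.
by rewrite -(sum_sqnorm_kraus v K1); apply: ler_sum => n _; exact: cost_le_sqnorm.
Qed.

(** * Positive semidefinite matrices as sums of rank-one matrices *)

Lemma trmxC_delta (C : numClosedFieldType) (m n : nat) (j : 'I_m) (k : 'I_n) :
  (delta_mx j k : 'M[C]_(m, n))^t* = delta_mx k j.
Proof. by rewrite trmx_delta map_delta_mx. Qed.

Lemma ketbra_delta (R : realType) (d : nat) (j : 'I_d) :
  ketbra (delta_mx j 0 : 'cV[R[i]]_d) = delta_mx j j.
Proof. by rewrite /ketbra trmxC_delta mul_delta_mx. Qed.

Lemma psdmx_hermitian (R : realType) (d : nat) (A : 'M[R[i]]_d) :
  psdmx A -> A^t* = A.
Proof.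
move=> pA.
(* Polarization: the quadratic form of A at e_j + a e_k is real. *)
have q (j k : 'I_d) (a : R[i]) :
    (A j j + a * A j k + Num.conj a * A k j + Num.conj a * a * A k k) \is Num.real.
  have := pA (delta_mx j 0 + a *: delta_mx k 0) => /ger0_real.
  have -> : (delta_mx j 0 + a *: delta_mx k 0 : 'cV_d)^t* =
      delta_mx 0 j + Num.conj a *: delta_mx 0 k.
    by rewrite linearD /= map_mxD linearZ /= map_mxZ !trmxC_delta.
  congr (_ \is Num.real).
  rewrite !mulmxDl !mulmxDr -!scalemxAl -!scalemxAr -!rowE -!colE.
  by rewrite !mxE; ring.
have diag j : A j j \is Num.real.
  have := q j j 0; by rewrite conjC0 !mul0r !addr0.
have off (j k : 'I_d) (a : R[i]) : Num.conj (a * A j k + Num.conj a * A k j)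
     = a * A j k + Num.conj a * A k j.
  apply/CrealP.
  have -> : a * A j k + Num.conj a * A k j =
    (A j j + a * A j k + Num.conj a * A k j + Num.conj a * a * A k k)
      - A j j - Num.conj a * a * A k k by ring.
  rewrite !rpredB // rpredM // mulrC -normCK; exact/rpredX/normr_real.
apply/matrixP => k j; rewrite !mxE.
(* Taking [a = 1] and [a = 'i] makes both A_jk + A_kj and i(A_jk - A_kj) real; ['i] times the first
   identity minus the second leaves conj(A_jk) = A_kj. *)
have h1 := off j k 1; have h2 := off j k 'i.
move: h1 h2; rewrite !rmorphD !rmorphM /= !conjCK !conjCi !conjC1 !mul1r => h1 h2.
have : 'i * (2 * (Num.conj (A j k) - A k j)) = 0 :> R[i].
  have -> : 'i * (2 * (Num.conj (A j k) - A k j)) =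
    'i * ((Num.conj (A j k) + Num.conj (A k j)) - (A j k + A k j))
    - ((- 'i * Num.conj (A j k) + 'i * Num.conj (A k j)) - ('i * A j k + - 'i * A k j)) by ring.
  by rewrite h1 h2 !subrr mulr0 subr0.
move=> /eqP; rewrite !mulf_eq0 (negPf (neq0Ci _)) pnatr_eq0 /= subr_eq0.
by move=> /eqP.
Qed.

(** Spectral theorem: the vectors are the eigenvectors, each scaled by the square root of its
    eigenvalue. *)
Lemma psdmx_sum_ketbra (R : realType) (d : nat) (A : 'M[R[i]]_d) :
  psdmx A -> exists s : seq 'cV[R[i]]_d, A = \sum_(v <- s) ketbra v.
Proof.
move=> pA; have nA : A \is normalmx by apply/normalmxP; rewrite psdmx_hermitian.
have /orthomx_spectralP := nA; rewrite invmx_unitary ?spectral_unitarymx //.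
have /unitarymxP := spectral_unitarymx A.
move: (spectralmx A) (spectral_diag A) => P D PP AE.
(* The eigenvalue is the value of the quadratic form at the eigenvector [P^t* *m delta_mx j 0]. *)
have Dge0 j : 0 <= D 0 j.
  have := pA (P^t* *m delta_mx j 0).
  rewrite trmx_mul map_mxM trmxCK trmxC_delta [X in _ *m X *m _]AE !mulmxA.
  rewrite -(mulmxA _ P) PP mulmx1 -(mulmxA _ P) PP mulmx1.
  by rewrite -rowE -colE !mxE eqxx.
exists [seq (Num.sqrt (complex.Re (D 0 j)))%:C *: (P^t* *m delta_mx j 0)
       | j <- enum 'I_d].
rewrite big_map big_enum /= AE diag_mx_sum_delta mulmx_sumr mulmx_suml.
apply: eq_bigr => j _.
rewrite ketbraZ -ketbra_mulmx trmxCK ketbra_delta sqr_sqrtr; last first.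
  by rewrite -ler0c (RRe_real (ger0_real (Dge0 j))).
by rewrite (RRe_real (ger0_real (Dge0 j))) -scalemxAr -scalemxAl.
Qed.

(** * Passing between pure-state ensembles and lists of unnormalized vectors *)

(** The set whose infimum is [CB rho], named so that general facts about [inf] apply to [CB] by
    conversion. *)
Definition ensemble_costs (R : realType) (d : nat) (rho : 'M[R[i]]_d) : set R :=
  [set x | exists (n : nat) (p : 'I_n -> R) (psi : 'I_n -> 'cV[R[i]]_d),
     pure_ensemble rho p psi /\ x = \sum_(i < n) p i * CB_pure (psi i)].

Lemma ensemble_costs_lbound (R : realType) (d : nat) (rho : 'M[R[i]]_d) :
  lbound (ensemble_costs rho) 0.
Proof.
move=> x [n [p [psi [[[p0 _] _ _] ->]]]].
apply: sumr_ge0 => i _; apply: mulr_ge0 => //.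
by rewrite /CB_pure; case: asboolP.
Qed.

(** Write each v as a u with u a unit vector: the weights a^2 = |v|^2 add up to the trace, which is
    1, and homogeneity turns a^2 [CB_pure u] into [cost v]. *)
Lemma sum_cost_ensemble (R : realType) (d : nat) (s : seq 'cV[R[i]]_d) :
  \tr (\sum_(v <- s) ketbra v) = 1 ->
  ensemble_costs (\sum_(v <- s) ketbra v) (\sum_(v <- s) cost v).
Proof.
move=> tr1; have tr1R : \sum_(v <- s) sqnorm v = 1.
  apply: complexI; rewrite rmorph_sum rmorph1 -tr1 raddf_sum /=.
  by apply: eq_bigr => v _; rewrite trace_ketbra.
(* An ensemble needs a unit vector even at weight 0, so zero vectors of the list are paired with
   [u0]. One exists because trace 1 excludes that all vectors vanish. *)
have [u0 u01] : exists u0 : 'cV[R[i]]_d, unit_vector u0.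
  have [[v v0]|/forallNP all0] := pselect (exists v : 'cV[R[i]]_d, v != 0).
    by have [a [u [_ u1 _]]] := normalize v0; exists u.
  have /eqP[] := oner_neq0 R; rewrite -tr1R big1 // => v _.
  by have /negP/negPn/eqP -> := all0 v; rewrite sqnorm0.
have polar (v : 'cV[R[i]]_d) : exists au : R * 'cV[R[i]]_d,
    unit_vector au.2 /\ v = au.1%:C *: au.2.
  have [->|/normalize[a [u [_ u1 ->]]]] := eqVneq v 0.
    by exists (0, u0); rewrite scale0r.
  by exists (a, u).
have [f fP] := choice polar.
pose t := in_tuple s.
exists (size s), (fun i => (f (tnth t i)).1 ^+ 2), (fun i => (f (tnth t i)).2).
have f1 v : (f v).1 ^+ 2 = sqnorm v.
  have [/unit_sqnorm u1 vE] := fP v.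
  by rewrite [in RHS]vE sqnormZ u1 mulr1.
split; first split.
- split=> [i|]; first exact: sqr_ge0.
  by rewrite -tr1R [RHS]big_tnth; apply: eq_bigr => i _; exact: f1.
- by move=> i; have [] := fP (tnth t i).
- rewrite [LHS]big_tnth; apply: eq_bigr => i _.
  by rewrite -ketbraZ; have [_ <-] := fP (tnth t i).
rewrite [LHS]big_tnth; apply: eq_bigr => i _.
have [u1 vE] := fP (tnth t i).
by rewrite CB_pure_cost // [in LHS]vE costZ.
Qed.

Lemma CB_le_sum_cost (R : realType) (d : nat) (s : seq 'cV[R[i]]_d) :
  \tr (\sum_(v <- s) ketbra v) = 1 ->
  CB (\sum_(v <- s) ketbra v) <= \sum_(v <- s) cost v.
Proof.
move=> /sum_cost_ensemble; apply: ge_inf.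
by exists 0; exact: ensemble_costs_lbound.
Qed.

(** Converse direction, up to [e]: take a near-optimal ensemble and absorb the square root of each
    probability into its vector. The spectral decomposition makes the set of values nonempty. *)
Lemma sum_cost_lt_CB (R : realType) (d : nat) (rho : 'M[R[i]]_d) (e : R) :
  density rho -> 0 < e -> exists s : seq 'cV[R[i]]_d,
    rho = \sum_(v <- s) ketbra v /\ \sum_(v <- s) cost v < CB rho + e.
Proof.
move=> [/psdmx_sum_ketbra[s0 rhoE] tr1] e0.
have hinf : has_inf (ensemble_costs rho).
  split; last by exists 0; exact: ensemble_costs_lbound.
  by exists (\sum_(v <- s0) cost v); rewrite rhoE; apply: sum_cost_ensemble; rewrite -rhoE.
have [_ [n [p [psi [[[p0 _] psi1 ->] ->]]]] lt] := inf_adherent e0 hinf.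
exists [seq (Num.sqrt (p i))%:C *: psi i | i <- enum 'I_n].
split; rewrite big_map big_enum /=.
  by apply: eq_bigr => i _; rewrite ketbraZ sqr_sqrtr.
apply: le_lt_trans lt; apply: ler_sum => i _.
by rewrite costZ sqr_sqrtr // CB_pure_cost.
Qed.

(** * Faithfulness (C1) *)

Lemma CB_ge0 (R : realType) (d : nat) (rho : 'M[R[i]]_d) :
  density rho -> 0 <= CB rho.
Proof.
move=> drho; apply/ler_addgt0Pr => e e0.
have [s [_ /ltW]] := sum_cost_lt_CB drho e0; apply: le_trans.
by apply: sumr_ge0 => v _; exact: cost_ge0.
Qed.

(** A diagonal state is the mixture of the basis states weighted by its diagonal entries, and this
    list has cost 0. *)
Lemma CB_incoherent (R : realType) (d : nat) (rho : 'M[R[i]]_d) :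
  incoherent rho -> CB rho = 0.
Proof.
move=> [drho diag_rho]; apply/eqP; rewrite eq_le CB_ge0 // andbT.
have [prho tr1] := drho.
have rge0 j : 0 <= rho j j.
  by have := prho (delta_mx j 0); rewrite trmxC_delta -rowE -colE !mxE.
pose s := [seq (Num.sqrt (complex.Re (rho j j)))%:C *: (delta_mx j 0 : 'cV_d)
          | j <- enum 'I_d].
have rhoE : rho = \sum_(v <- s) ketbra v.
  have /diag_mxP[D rD] := diag_rho.
  rewrite big_map big_enum /= [LHS]rD diag_mx_sum_delta; apply: eq_bigr => j _.
  have Djj : D 0 j = rho j j by rewrite rD mxE eqxx.
  have rjR := RRe_real (ger0_real (rge0 j)).
  by rewrite ketbraZ ketbra_delta sqr_sqrtr ?rjR ?Djj // -ler0c rjR.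
rewrite {1}rhoE; apply: (le_trans (CB_le_sum_cost _)); rewrite -?rhoE //.
rewrite big_map big1 // => j _.
rewrite costZ /cost ketbra_delta ifT ?mulr0 //; apply/is_diag_mxP => x y xy.
rewrite mxE; case: andP => // -[/eqP xj /eqP yj].
by rewrite xj yj eqxx in xy.
Qed.

(** For non-diagonal |v><v|, the entry has modulus |v_j||v_k| <= |v_j|^2 + |v_k|^2 <= |v|^2; the
    last step uses j != k. *)
Lemma norm_offdiag_ketbra (R : realType) (d : nat) (v : 'cV[R[i]]_d) j k :
  j != k -> `|ketbra v j k| <= (cost v)%:C.
Proof.
move=> jk; rewrite /cost; case: ifPn => [/is_diag_mxP ->//|_].
  by rewrite normr0.
rewrite ketbraE normrM norm_conjC sqnorm_sum (bigD1 j) //= (bigD1 k) 1?eq_sym//=.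
apply: (@le_trans _ _ (`|v j 0| ^+ 2 + `|v k 0| ^+ 2)); last first.
  rewrite addrA lerDl; apply: sumr_ge0 => l _; exact/exprn_ge0/normr_ge0.
rewrite -subr_ge0.
have -> : `|v j 0| ^+ 2 + `|v k 0| ^+ 2 - `|v j 0| * `|v k 0| =
  (`|v j 0| - `|v k 0|) ^+ 2 + `|v j 0| * `|v k 0| by ring.
apply: addr_ge0; last exact: mulr_ge0.
by rewrite real_exprn_even_ge0 // rpredB ?normr_real.
Qed.

Lemma norm_offdiag_le_CB (R : realType) (d : nat) (rho : 'M[R[i]]_d) j k :
  density rho -> j != k -> `|rho j k| <= (CB rho)%:C.
Proof.
(* The modulus is rewritten as a real number so that the slack [e] can be added in [R]. *)
move=> drho jk; rewrite normc_def lecR; apply/ler_addgt0Pr => e e0.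
have [s [rhoE /ltW]] := sum_cost_lt_CB drho e0; apply: le_trans.
rewrite -lecR -normc_def rhoE summxE rmorph_sum.
apply: (le_trans (ler_norm_sum _ _ _)); apply: ler_sum => v _.
exact: norm_offdiag_ketbra.
Qed.

(** * Monotonicity (C2), (C3) and convexity (C4) *)

Lemma trace_kraus (R : realType) (d : nat) (K : 'M[R[i]]_d) (s : seq 'cV[R[i]]_d) :
  \tr (K *m (\sum_(v <- s) ketbra v) *m K^t*) =
    (\sum_(v <- s) sqnorm (K *m v))%:C.
Proof.
rewrite mulmx_sumr mulmx_suml raddf_sum rmorph_sum /=; apply: eq_bigr => v _.
by rewrite ketbra_mulmx trace_ketbra.
Qed.

Lemma CB_strong_monotone (R : realType) (d N : nat) (K : 'I_N -> 'M[R[i]]_d)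
    (rho : 'M[R[i]]_d) :
  incoherent_kraus_family K -> density rho ->
  \sum_(n < N | outcome_prob (K n) rho != 0)
    outcome_prob (K n) rho * CB (outcome_state (K n) rho) <= CB rho.
Proof.
move=> iK drho; apply/ler_addgt0Pr => e e0.
have [s [rhoE /ltW]] := sum_cost_lt_CB drho e0; apply: le_trans.
apply: (@le_trans _ _ (\sum_(v <- s) \sum_(n < N) cost (K n *m v))); last first.
  by apply: ler_sum => v _; exact: sum_cost_kraus.
(* The comparison is made outcome by outcome; an omitted outcome only leaves a nonnegative cost on
   the right. *)
rewrite exchange_big big_mkcond; apply: ler_sum => n _ /=.
case: ifPn => [q0|_]; last by apply: sumr_ge0 => v _; exact: cost_ge0.
have qE : \tr (K n *m rho *m (K n)^t*) = (outcome_prob (K n) rho)%:C.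
  by rewrite /outcome_prob rhoE trace_kraus.
have qpos : 0 < outcome_prob (K n) rho.
  rewrite lt_neqAle eq_sym q0 /outcome_prob rhoE trace_kraus /=.
  by apply: sumr_ge0 => v _; exact: sqnorm_ge0.
rewrite /outcome_state; move: (outcome_prob _ _) qE qpos {q0} => q qE qpos.
(* Scaling the vectors K_n v by q^(-1/2) gives a list of trace 1 for the normalized outcome; its
   cost carries a factor 1/q, which cancels the weight q. *)
pose a := Num.sqrt q^-1.
have a2 : a ^+ 2 = q^-1 by rewrite sqr_sqrtr // invr_ge0 ltW.
have sE : (q^-1)%:C *: (K n *m rho *m (K n)^t*) =
    \sum_(w <- [seq a%:C *: (K n *m v) | v <- s]) ketbra w.
  rewrite big_map rhoE mulmx_sumr mulmx_suml scaler_sumr; apply: eq_bigr => v _.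
  by rewrite ketbraZ a2 ketbra_mulmx.
have /CB_le_sum_cost : \tr (\sum_(w <- [seq a%:C *: (K n *m v) | v <- s]) ketbra w) = 1.
  by rewrite -sE mxtraceZ qE -rmorphM /= mulVf ?gt_eqF.
rewrite -sE big_map => h.
rewrite -ler_pdivlMl //; apply: (le_trans h).
by rewrite mulr_sumr; apply: ler_sum => v _; rewrite costZ a2.
Qed.

Lemma CB_monotone (R : realType) (d : nat) (Lambda : 'M[R[i]]_d -> 'M[R[i]]_d)
    (rho : 'M[R[i]]_d) :
  incoherent_operation Lambda -> density rho -> CB (Lambda rho) <= CB rho.
Proof.
move=> [N [K [iK LE]]] drho; apply/ler_addgt0Pr => e e0.
have [s [rhoE /ltW]] := sum_cost_lt_CB drho e0; apply: le_trans.
(* The images of the list under all K_n, put together, decompose [Lambda rho]. *)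
pose t := [seq K n *m v | n <- enum 'I_N, v <- s].
have tE : Lambda rho = \sum_(w <- t) ketbra w.
  rewrite big_allpairs_dep big_enum LE; apply: eq_bigr => n _.
  rewrite rhoE mulmx_sumr mulmx_suml; apply: eq_bigr => v _.
  exact: ketbra_mulmx.
have /CB_le_sum_cost : \tr (\sum_(w <- t) ketbra w) = 1.
  have [_ <-] := drho; rewrite -tE LE raddf_sum /=.
  under eq_bigr do rewrite mxtrace_mulC mulmxA.
  by rewrite -raddf_sum /= -mulmx_suml iK.1 mul1mx.
rewrite -tE => h; apply: (le_trans h).
rewrite big_allpairs_dep big_enum exchange_big /=; apply: ler_sum => v _.
exact: sum_cost_kraus.
Qed.

Lemma CB_convex (R : realType) (d m : nat) (p : 'I_m -> R)
    (rho : 'I_m -> 'M[R[i]]_d) :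
  prob_vector p -> (forall i, density (rho i)) ->
  CB (\sum_(i < m) (p i)%:C *: rho i) <= \sum_(i < m) p i * CB (rho i).
Proof.
move=> [p0 p1] drho; apply/ler_addgt0Pr => e e0.
have [s sP] := choice (fun i => sum_cost_lt_CB (drho i) e0).
(* Concatenation of the lists of the [rho i], scaled so that the i-th one sums to p_i rho_i. *)
pose t := [seq (Num.sqrt (p i))%:C *: v | i <- enum 'I_m, v <- s i].
have tE : \sum_(i < m) (p i)%:C *: rho i = \sum_(w <- t) ketbra w.
  rewrite big_allpairs_dep big_enum; apply: eq_bigr => i _.
  rewrite [in LHS](sP i).1 scaler_sumr; apply: eq_bigr => v _.
  by rewrite ketbraZ sqr_sqrtr.
have /CB_le_sum_cost : \tr (\sum_(w <- t) ketbra w) = 1.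
  rewrite -tE raddf_sum -(rmorph1 (real_complex R)) -p1 rmorph_sum /=.
  by apply: eq_bigr => i _; rewrite mxtraceZ (drho i).2 mulr1.
rewrite -tE => h; apply: (le_trans h).
(* Each list has the same slack [e], and the average of these slacks under [p] is again [e]. *)
rewrite -[e]mul1r -p1 mulr_suml -big_split big_allpairs_dep big_enum /=.
apply: ler_sum => i _; rewrite -mulrDr.
under eq_bigr do rewrite costZ sqr_sqrtr //.
by rewrite -mulr_sumr ler_wpM2l // ltW // (sP i).2.
Qed.

Theorem mainTheorem3 (R : realType) (d : nat) :
  coherence_measure (@CB R d).
Proof.
split.
- move=> rho drho; split; first exact: CB_ge0.
  split=> [CB0|]; last exact: CB_incoherent.
  split=> //; apply/is_diag_mxP => j k jk; apply/eqP.
  by rewrite -normr_le0 (le_trans (norm_offdiag_le_CB drho jk)) // CB0.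
- exact: CB_monotone.
- exact: CB_strong_monotone.
- exact: CB_convex.
Qed.
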